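(* Let $\mathcal{S}=\{S_k\le\mathrm{Sym}(m_k)\}_{k\in\mathbb{N}}$ be a sequence of finite $2$-generated perfect transitive permutation groups, with $m_k\ge 2$ for all $k$. Suppose that for every $k\in\mathbb{N}$ there exist two generators $a_k,b_k$ of $S_k$ (that is, $S_k=\langle a_k,b_k\rangle$) such that: (i) $\mathrm{fix}(a_k)$ and $\mathrm{fix}(b_k)$ are non-empty for every $k\in\mathbb{N}$; (ii) $\gcd(|a_1|,|b_j|)=1$ and $\gcd(|b_1|,|a_j|)=1$ for every $j\ge 2$. Then the infinitely iterated exponentiation $\varprojlim\widetilde{S}_k$ of the groups in $\mathcal{S}$ is topologically generated by two elements.
   Context: Here $\mathbb{N}=\{1,2,3,\ldots\}$, actions are right actions, $\mathrm{Sym}(m)$ is the symmetric group on $\{1,\ldots,m\}$, $\mathrm{fix}(a)$ is the set of points of $\{1,\ldots,m_k\}$ fixed by $a\in S_k$, and $|a|$ is the order of the element $a$. Exponentiation: for permutation groups $A\le \mathrm{Sym}(m)$ and $B\le\mathrm{Sym}(n)$, the abstract wreath product is $A^n\rtimes B$, where $B$ permutes the $n$ coordinates of $A^n$ (the entry in position $t$ is moved by $b\in B$ to position $t^b$). The exponentiation of $A$ by $B$ is this group regarded as a permutation group on $\{1,\ldots,m\}^n$ with the product action: $(a_1,\ldots,a_n)\in A^n$ acts by $(i_1,\ldots,i_n)\mapsto (i_1^{a_1},\ldots,i_n^{a_n})$, and $b\in B$ permutes coordinates, moving the entry in position $t$ to position $t^b$. Iterated exponentiation: put $\widetilde{m}_1=m_1$,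 $\widetilde{S}_1=S_1\le\mathrm{Sym}(\widetilde{m}_1)$, and for $k\ge 2$ let $\widetilde{m}_k=m_k^{\widetilde{m}_{k-1}}$ and let $\widetilde{S}_k=S_k^{\widetilde{m}_{k-1}}\rtimes\widetilde{S}_{k-1}$ be the exponentiation of $S_k$ by $\widetilde{S}_{k-1}$, acting on $\{1,\ldots,m_k\}^{\widetilde{m}_{k-1}}$, which is identified with $\{1,\ldots,\widetilde{m}_k\}$ via the lexicographic order. The groups $\widetilde{S}_k$ with the natural projections $\widetilde{S}_k\to\widetilde{S}_{k-1}$ form an inverse system of finite groups; the profinite group $\varprojlim\widetilde{S}_k$ is the infinitely iterated exponentiation of the groups in $\mathcal{S}$. *)

(* Defs.v *)
From HB Require Import structures.
From mathcomp Require Import all_boot all_order all_fingroup all_solvable.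
From mathcomp Require Import mathcomp_extra boolp classical_sets topology.

Set Implicit Arguments.
Unset Strict Implicit.
Unset Printing Implicit Defensive.

Import GroupScope.

(* Permutations act on the right, as always in MathComp: (s * t) x = t (s x).
   Points and coordinates are numbered from 0 instead of 1. *)

Section LexIdentification.
Variables (m n : nat).

Lemma card_lex : #|{: n.-tuplelexi 'I_m}| = (m ^ n)%N.
Proof. by rewrite card_tuple card_ord. Qed.

(* The order-preserving bijection between {0, .., m ^ n - 1} and the n-tuples
   over {0, .., m - 1} in lexicographic order. *)
Definition lex_tuple (i : 'I_(m ^ n)%N) : n.-tuple 'I_m :=
  @Order.enum_val _ (n.-tuplelexi 'I_m)%type predT
    (cast_ord (esym card_lex) i).

Definition lex_rank (u : n.-tuple 'I_m) : 'I_(m ^ n)%N :=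
  cast_ord card_lex (Order.enum_rank (u : n.-tuplelexi 'I_m)).

Lemma lex_tupleK : cancel lex_tuple lex_rank.
Proof.
by move=> i; rewrite /lex_rank /lex_tuple Order.EnumVal.enum_valK cast_ordKV.
Qed.

Lemma lex_rankK : cancel lex_rank lex_tuple.
Proof.
by move=> u; rewrite /lex_rank /lex_tuple cast_ordK Order.EnumVal.enum_rankK.
Qed.

End LexIdentification.

Section Exponentiation.
Variables (m n : nat).
Implicit Types (a : {ffun 'I_n -> {perm 'I_m}}) (b : {perm 'I_n}).

Definition base_fun a (i : 'I_(m ^ n)%N) : 'I_(m ^ n)%N :=
  lex_rank [tuple a t (tnth (lex_tuple i) t) | t < n].

(* The entry in position t moves to position b t. *)
Definition top_fun b (i : 'I_(m ^ n)%N) : 'I_(m ^ n)%N :=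
  lex_rank [tuple tnth (lex_tuple i) (b^-1 t) | t < n].

Lemma base_fun_inj a : injective (base_fun a).
Proof.
move=> i j /(can_inj (@lex_rankK m n)) E.
apply: (can_inj (@lex_tupleK m n)); apply: eq_from_tnth => t.
by move: (congr1 (fun u : n.-tuple 'I_m => tnth u t) E); rewrite !tnth_mktuple => /perm_inj.
Qed.

Lemma top_fun_inj b : injective (top_fun b).
Proof.
move=> i j /(can_inj (@lex_rankK m n)) E.
apply: (can_inj (@lex_tupleK m n)); apply: eq_from_tnth => t.
by move: (congr1 (fun u : n.-tuple 'I_m => tnth u (b t)) E); rewrite !tnth_mktuple permK.
Qed.

Definition base_perm a : {perm 'I_(m ^ n)%N} := perm (@base_fun_inj a).
Definition top_perm b : {perm 'I_(m ^ n)%N} := perm (@top_fun_inj b).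

Lemma tnth_base a i t :
  tnth (lex_tuple (base_perm a i)) t = a t (tnth (lex_tuple i) t).
Proof. by rewrite permE /base_fun lex_rankK tnth_mktuple. Qed.

Lemma tnth_top b i t :
  tnth (lex_tuple (top_perm b i)) t = tnth (lex_tuple i) (b^-1 t).
Proof. by rewrite permE /top_fun lex_rankK tnth_mktuple. Qed.

Lemma lex_permP (p q : {perm 'I_(m ^ n)%N}) :
  (forall i t, tnth (lex_tuple (p i)) t = tnth (lex_tuple (q i)) t) -> p = q.
Proof.
move=> E; apply/permP => i; apply: (can_inj (@lex_tupleK m n)).
exact: eq_from_tnth.
Qed.

Lemma base_top_mul a b a' b' :
  (base_perm a * top_perm b) * (base_perm a' * top_perm b') =
  base_perm [ffun t => a t * a' (b t)] * top_perm (b * b').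
Proof.
apply: lex_permP => i t.
by rewrite !permM !(tnth_base, tnth_top) ffunE permM invMg permM permKV.
Qed.

Lemma base1 : base_perm [ffun=> 1] = 1.
Proof. by apply: lex_permP => i t; rewrite tnth_base ffunE !perm1. Qed.

Lemma top1 : top_perm 1 = 1.
Proof. by apply: lex_permP => i t; rewrite tnth_top invg1 !perm1. Qed.

Variables (A : {group {perm 'I_m}}) (B : {group {perm 'I_n}}).

Definition exponentiation_set : {set {perm 'I_(m ^ n)%N}} :=
  [set base_perm a * top_perm b | a in ffun_on (mem A), b in B].

Lemma exponentiation_group_set : group_set exponentiation_set.
Proof.
apply/group_setP; split.
  apply/imset2P; exists [ffun=> 1] 1; rewrite ?group1 ?base1 ?top1 ?mulg1 //.
  by apply/ffun_onP => t; rewrite ffunE group1.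
move=> _ _ /imset2P[a b /ffun_onP Aa Bb ->] /imset2P[a' b' /ffun_onP Aa' Bb' ->].
apply/imset2P; exists [ffun t => a t * a' (b t)] (b * b').
- by apply/ffun_onP => t; rewrite ffunE groupM ?Aa ?Aa'.
- by rewrite groupM.
- exact: base_top_mul.
Qed.

Definition exponentiation : {group {perm 'I_(m ^ n)%N}} :=
  Group exponentiation_group_set.

(* The projection of the wreath product onto its top group: (a, b) |-> b.
   For 1 < m the product action is faithful, so that b is determined by the
   permutation; see expo_projE. *)
Definition expo_proj (p : {perm 'I_(m ^ n)%N}) : {perm 'I_n} :=
  odflt 1 [pick b in B | [exists a in ffun_on (mem A),
                            p == base_perm a * top_perm b]].

Lemma top_unique a b a' b' : 1 < m ->
  base_perm a * top_perm b = base_perm a' * top_perm b' -> b = b'.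
Proof.
move=> m_gt1 E; apply: invg_inj; apply/permP => t; apply/eqP; apply: contraT.
move=> neq_t; pose x0 : 'I_m := Ordinal (ltnW m_gt1).
pose x1 : 'I_m := Ordinal m_gt1.
pose u x := lex_rank [tuple if s == b^-1 t then x else x0 | s < n].
have uE x s : tnth (lex_tuple (u x)) s = if s == b^-1 t then x else x0.
  by rewrite /u lex_rankK tnth_mktuple.
have H x : a (b^-1 t) x = a' (b'^-1 t) x0.
  have := congr1 (fun p : {perm _} => tnth (lex_tuple (p (u x))) t) E.
  by rewrite !permM !(tnth_top, tnth_base) !uE eqxx eq_sym (negbTE neq_t).
by have /perm_inj := etrans (H x0) (esym (H x1)).
Qed.

Lemma expo_projE a b : 1 < m -> a \in ffun_on (mem A) -> b \in B ->
  expo_proj (base_perm a * top_perm b) = b.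
Proof.
move=> m_gt1 Aa Bb; rewrite /expo_proj; case: pickP => [b' | /(_ b)] /=.
  by case/andP=> _ /exists_inP[a' _ /eqP/(top_unique m_gt1)].
by rewrite Bb => /exists_inP[]; exists a.
Qed.

Lemma expo_projM : 1 < m ->
  {in exponentiation &, {morph expo_proj : p q / p * q}}.
Proof.
move=> m_gt1 _ _ /imset2P[a b Aa Bb ->] /imset2P[a' b' Aa' Bb' ->].
rewrite base_top_mul !expo_projE ?groupM //.
by apply/ffun_onP => t; rewrite ffunE groupM ?(ffun_onP Aa) ?(ffun_onP Aa').
Qed.

Definition expo_proj_morphism (m_gt1 : 1 < m) :
  {morphism exponentiation >-> {perm 'I_n}} := Morphism (expo_projM m_gt1).

End Exponentiation.

(* The sequence S_1, S_2, .. is indexed from 0. *)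
Fixpoint iter_deg (m : nat -> nat) (k : nat) : nat :=
  if k is k'.+1 then (m k ^ iter_deg m k')%N else m 0.

Fixpoint iter_expo (m : nat -> nat) (S : forall k, {group {perm 'I_(m k)}})
    (k : nat) : {group {perm 'I_(iter_deg m k)}} :=
  match k with
  | 0 => S 0
  | k'.+1 => exponentiation (S k'.+1) (iter_expo S k')
  end.

Definition iter_expo_proj (m : nat -> nat) (m_gt1 : forall k, 1 < m k)
    (S : forall k, {group {perm 'I_(m k)}}) (k : nat) :
    {morphism iter_expo S k.+1 >-> {perm 'I_(iter_deg m k)}} :=
  expo_proj_morphism (S k.+1) (iter_expo S k) (m_gt1 k.+1).


Local Open Scope classical_set_scope.

HB.mixin Record isTopologicalGroup G & monoid.Group G & Topological G := {
  mulg_continuous : continuous (fun x : G * G => (x.1 * x.2)%g);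
  invg_continuous : continuous (fun x : G => x^-1%g)
}.

#[short(type="topologicalGroupType")]
HB.structure Definition TopologicalGroup :=
  {G of monoid.Group G & Topological G & isTopologicalGroup G}.

Definition generated_subgroup (G : groupType) (X : set G) : set G :=
  smallest [set H | H 1%g /\ forall x y, H x -> H y -> H (x * y^-1)%g] X.

Definition topologically_2_generated (G : topologicalGroupType) : Prop :=
  exists x y : G, dense (generated_subgroup [set x; y]).

Section InverseLimit.
Variables (gT : nat -> finGroupType) (G : forall k, {group gT k}).
Variable pi : forall k, {morphism G k.+1 >-> gT k}.

(* Subspace of the product of the discrete spaces gT k. *)
Definition inverse_limit_set : set (prod_topology (fun k => discrete_topology (gT k))) :=
  [set x | forall k, x k \in G k /\ pi k (x k.+1) = x k].

Definition inverse_limit : Type := inverse_limit_set.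

HB.instance Definition _ := Topological.on inverse_limit.

Implicit Types x y z : inverse_limit.

Lemma inverse_limitP x : inverse_limit_set (val x).
Proof. exact: set_mem (valP x). Qed.

Lemma inverse_limit_mul_subproof x y :
  inverse_limit_set (fun k => (val x k : gT k) * (val y k : gT k))%g.
Proof.
move=> k; have [Gx ex] := inverse_limitP x k; have [Gy ey] := inverse_limitP y k.
have [Gx' _] := inverse_limitP x k.+1; have [Gy' _] := inverse_limitP y k.+1.
by rewrite groupM // morphM // ex ey.
Qed.

Lemma inverse_limit_one_subproof : inverse_limit_set (fun k => 1%g : gT k).
Proof. by move=> k; rewrite group1 morph1. Qed.

Lemma inverse_limit_inv_subproof x :
  inverse_limit_set (fun k => (val x k : gT k)^-1)%g.
Proof.
move=> k; have [Gx ex] := inverse_limitP x k.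
have [Gx' _] := inverse_limitP x k.+1.
by rewrite groupV // morphV // ex.
Qed.

Definition inverse_limit_mul x y : inverse_limit :=
  exist (fun u => u \in inverse_limit_set) _ (mem_set (inverse_limit_mul_subproof x y)).
Definition inverse_limit_one : inverse_limit :=
  exist (fun u => u \in inverse_limit_set) _ (mem_set inverse_limit_one_subproof).
Definition inverse_limit_inv x : inverse_limit :=
  exist (fun u => u \in inverse_limit_set) _ (mem_set (inverse_limit_inv_subproof x)).

Lemma inverse_limit_eq x y : (forall k, val x k = val y k) -> x = y.
Proof. by move=> E; apply: val_inj; apply: functional_extensionality_dep. Qed.

Lemma inverse_limit_mulA : associative inverse_limit_mul.
Proof. by move=> x y z; apply: inverse_limit_eq => k; apply: mulgA. Qed.
Lemma inverse_limit_mul1 : left_id inverse_limit_one inverse_limit_mul.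
Proof. by move=> x; apply: inverse_limit_eq => k; apply: mul1g. Qed.
Lemma inverse_limit_mulr1 : right_id inverse_limit_one inverse_limit_mul.
Proof. by move=> x; apply: inverse_limit_eq => k; apply: mulg1. Qed.
Lemma inverse_limit_mulV :
  left_inverse inverse_limit_one inverse_limit_inv inverse_limit_mul.
Proof. by move=> x; apply: inverse_limit_eq => k; apply: mulVg. Qed.
Lemma inverse_limit_mulrV :
  right_inverse inverse_limit_one inverse_limit_inv inverse_limit_mul.
Proof. by move=> x; apply: inverse_limit_eq => k; apply: mulgV. Qed.

HB.instance Definition _ := isGroup.Build inverse_limit
  inverse_limit_mulA inverse_limit_mul1 inverse_limit_mulr1
  inverse_limit_mulV inverse_limit_mulrV.

Lemma inverse_limit_near k x : \forall y \near x, val y k = val x k.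
Proof.
pose T k : topologicalType := discrete_topology (gT k).
pose f (y : inverse_limit) : T k := (val y : prod_topology T) k.
have cf : {for x, continuous f}.
  have c1 : {for x, continuous (fun y : inverse_limit => val y : prod_topology T)}.
    exact: initial_continuous.
  exact: (continuous_comp c1 (@proj_continuous _ T k (val x))).
by have := cf _ (discrete_set1 (f x)).
Qed.

Lemma inverse_limit_continuous (T : topologicalType) (f : T -> inverse_limit) :
  (forall k t, \forall s \near t, val (f s) k = val (f t) k) -> continuous f.
Proof.
move=> H; apply/continuous_comp_initial => t; apply/cvg_sup => k.
move=> U [V [[B oB <-] /= Bt BU]].
rewrite nbhs_filterE /=; near=> s; apply: BU => /=.
have E : val (f s) k = val (f t) k by near: s; exact: H.
exact: (eq_ind_r B Bt E).
Unshelve. all: by end_near. Qed.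

Lemma inverse_limit_mul_continuous :
  continuous (fun x : inverse_limit * inverse_limit => (x.1 * x.2)%g).
Proof.
apply: inverse_limit_continuous => k [x y].
have := inverse_limit_near k x; have := inverse_limit_near k y => Hy Hx.
near=> z; rewrite /= /inverse_limit_mul /=; congr (_ * _)%g.
  by near: z; apply: cvg_fst Hx.
by near: z; apply: cvg_snd Hy.
Unshelve. all: by end_near. Qed.

Lemma inverse_limit_inv_continuous :
  continuous (fun x : inverse_limit => x^-1%g).
Proof.
apply: inverse_limit_continuous => k x.
have := inverse_limit_near k x; apply: filterS => y /= E.
by congr (_^-1)%g.
Qed.

HB.instance Definition _ := isTopologicalGroup.Build inverse_limit
  inverse_limit_mul_continuous inverse_limit_inv_continuous.

End InverseLimit.

Definition infinite_iter_expo (m : nat -> nat) (m_gt1 : forall k, 1 < m k)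
    (S : forall k, {group {perm 'I_(m k)}}) : topologicalGroupType :=
  inverse_limit (iter_expo_proj m_gt1 S).

(* Main.v *)
From mathcomp Require Import boolp classical_sets topology.
Require Import Defs.
From mathcomp Require Import all_boot all_fingroup all_solvable.

(** Let [c := a 0, b 1, b 2, ...] and [d := b 0, a 1, a 2, ...].  The two
    generators are built level by level: a generator of level [k] is lifted to
    level [k.+1] by multiplying it with one factor [c k.+1] (resp. [d k.+1])
    placed in a single coordinate of the base group, the anchor.  The anchor is
    fixed by the generator of level [k], so the new factor commutes with it,
    and for [0 < k] it is a constant tuple, so it is fixed by the whole top
    group of the wreath product of level [k].

    Fix a level [k], let [x] and [y] be its two generators and [H] the group
    that they generate.  Since [x] is a product of commuting factors, the first
    of which has order prime to the orders of the others, [H] contains [c 0]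
    and the product of the other factors, and likewise for [y] and [d 0].
    Hence [H] contains the copy of [S 0 = <<[set c 0; d 0]>>] in the top of the
    tower.  Suppose now that [H] contains the copy of the group of level [j] in
    the top of the tower, and write the rest of [x] as [u * z], with [u] the
    factor [c j.+1] in its anchor.  That copy commutes with [z], because it
    fixes the later anchors, and by transitivity it has elements [s] that move
    the coordinate of [u] to any other, so
    [[~ u * z, s] = u^-1 * u ^ s] is in [H]: in two chosen coordinates it is
    [(c j.+1)^-1] and [c j.+1].  Doing the same with [d j.+1], two such
    elements that share just one coordinate have as their commutator
    [[~ c j.+1, d j.+1]] in that coordinate alone.  The elements of [S j.+1]
    whose copy in one coordinate lies in [H] form a normal subgroup with
    abelian quotient, which is everything because [S j.+1] is perfect.  So [H]
    contains the copy of level [j.+1].  The induction is carried out in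
    [iter_expo_sub_twisted], which treats the remaining factors [z] of the
    larger tower as an abstract element of an abstract finite group.

    Finally, an open neighbourhood of a point of the inverse limit contains all
    points that agree with it in some single coordinate, so generating every
    finite level is enough for density: [inverse_limit_generated]. *)

Set Implicit Arguments.
Unset Strict Implicit.
Unset Printing Implicit Defensive.

Import GroupScope.

(** * Coordinate subgroups of the product action *)

Section ProductAction.
Variables m n : nat.
Implicit Types (u v : {ffun 'I_n -> {perm 'I_m}}) (s : {perm 'I_n}).
Implicit Types (p q r t : 'I_n) (g h : {perm 'I_m}).

Lemma base_permM u v :
  base_perm u * base_perm v = base_perm [ffun t => u t * v t].
Proof. by apply: lex_permP => i t; rewrite permM !tnth_base ffunE permM. Qed.

Lemma base_permV u : (base_perm u)^-1 = base_perm [ffun t => (u t)^-1].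
Proof.
apply/eqP; rewrite eq_invg_mul base_permM -base1; apply/eqP; congr base_perm.
by apply/ffunP=> t; rewrite !ffunE mulgV.
Qed.

Lemma base_permR u v :
  [~ base_perm u, base_perm v] = base_perm [ffun t => [~ u t, v t]].
Proof.
rewrite !commgEl conjgE !(base_permV, base_permM); congr base_perm.
by apply/ffunP=> t; rewrite !ffunE commgEl conjgE.
Qed.

Lemma top_permM : {morph @top_perm m n : s t / s * t}.
Proof.
move=> s t; apply: lex_permP => i r.
by rewrite permM !tnth_top invMg permM.
Qed.

Lemma base_permJ u s :
  base_perm u ^ top_perm m s = base_perm [ffun t => u (s^-1 t)].
Proof.
apply: (mulgI (top_perm m s)); rewrite -conjgC; apply: lex_permP => i t.
by rewrite !permM !(tnth_base, tnth_top) ffunE.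
Qed.

Definition single p g : {perm 'I_(m ^ n)%N} :=
  base_perm [ffun t => if t == p then g else 1].

Lemma singleM p : {morph single p : g h / g * h}.
Proof.
move=> g h; rewrite /single base_permM; congr base_perm.
by apply/ffunP=> t; rewrite !ffunE; case: eqP; rewrite ?mulg1.
Qed.

Lemma single1 p : single p 1 = 1.
Proof. by apply: (mulgI (single p 1)); rewrite -singleM !mulg1. Qed.

Lemma singleV p g : single p g^-1 = (single p g)^-1.
Proof. by apply/eqP; rewrite eq_sym eq_invg_mul -singleM mulgV single1. Qed.

Lemma singleX p g k : single p (g ^+ k) = single p g ^+ k.
Proof.
by elim: k => [|k IH]; rewrite ?single1 // !expgS singleM IH.
Qed.

Lemma singleJ p g s : single p g ^ top_perm m s = single (s p) g.
Proof.
rewrite /single base_permJ; congr base_perm; apply/ffunP=> t.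
by rewrite !ffunE (can2_eq (permKV s) (permK s)).
Qed.

Lemma single_commute_top p g s : s p = p ->
  commute (single p g) (top_perm m s).
Proof. by move=> sp; apply/commgP/conjg_fixP; rewrite singleJ sp. Qed.

Lemma single_commute p q g h : p != q -> commute (single p g) (single q h).
Proof.
move=> pq; rewrite /commute /single !base_permM; congr base_perm.
apply/ffunP=> t; rewrite !ffunE; case: (eqVneq t p) => [->|_].
  by rewrite (negbTE pq) mulg1 mul1g.
by case: eqP; rewrite ?mulg1 ?mul1g.
Qed.

(** The factor in coordinate [q] does not touch coordinate [p]: elements with
    cancelling entries conjugate a coordinate like full elements do. *)
Lemma single_conj p q g h : p != q ->
  single p g ^ ((single q h)^-1 * single p h) = single p (g ^ h).
Proof.
move=> pq; rewrite conjgM.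
have /conjg_fixP -> : [~ single p g, (single q h)^-1] == 1.
  by apply/commgP/commuteV/single_commute.
by rewrite !conjgE !singleM singleV.
Qed.

(** Only coordinate [p] carries nontrivial entries of both elements. *)
Lemma single_commutator p q r g h : p != q -> p != r -> q != r ->
  [~ (single q g)^-1 * single p g, (single r h)^-1 * single p h] =
  single p [~ g, h].
Proof.
move=> pq pr qr; rewrite -!singleV /single !base_permM base_permR.
congr base_perm; apply/ffunP=> t; rewrite !ffunE.
case: (eqVneq t p) => [->|_]; first by rewrite (negbTE pq) (negbTE pr) !mul1g.
rewrite !mulg1; case: (eqVneq t q) => [->|_].
  by rewrite (negbTE qr) commg1.
by rewrite comm1g.
Qed.

Lemma base_perm_in (H : {group {perm 'I_(m ^ n)%N}}) u :
  (forall t, single t (u t) \in H) -> base_perm u \in H.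
Proof.
move=> Hu.
have Hs (l : seq 'I_n) :
    base_perm [ffun t => if t \in l then u t else 1] \in H.
  elim: l => [|q l IH].
    by rewrite (_ : [ffun _ => _] = [ffun=> 1]) ?base1.
  case lq: (q \in l).
    rewrite (_ : [ffun _ => _] = [ffun t => if t \in l then u t else 1]) //.
    by apply/ffunP=> t; rewrite !ffunE inE; case: eqP => // ->; rewrite lq.
  rewrite (_ : base_perm _ = single q (u q) *
             base_perm [ffun t => if t \in l then u t else 1]) ?groupM //.
  rewrite base_permM; congr base_perm; apply/ffunP=> t; rewrite !ffunE inE.
  by case: eqP => [->|_] /=; rewrite ?lq ?mulg1 ?mul1g.
rewrite (_ : u = [ffun t => if t \in enum 'I_n then u t else 1]) //.
by apply/ffunP=> t; rewrite ffunE mem_enum.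
Qed.

Definition const_point (i : 'I_m) : 'I_(m ^ n)%N := lex_rank [tuple i | _ < n].

Lemma top_const_point i s : top_perm m s (const_point i) = const_point i.
Proof.
apply: (can_inj (@lex_tupleK m n)); apply: eq_from_tnth => t.
by rewrite tnth_top lex_rankK !tnth_mktuple.
Qed.

Lemma single_const_point i p g : g i = i ->
  single p g (const_point i) = const_point i.
Proof.
move=> gi; apply: (can_inj (@lex_tupleK m n)); apply: eq_from_tnth => t.
rewrite tnth_base lex_rankK !tnth_mktuple ffunE.
by case: eqP; rewrite ?perm1.
Qed.

(** The base group alone is already transitive. *)
Lemma exponentiation_transitive (A : {group {perm 'I_m}})
    (B : {group {perm 'I_n}}) : 0 < m ->
  [transitive A, on [set: 'I_m] | 'P] ->
  [transitive exponentiation A B, on [set: 'I_(m ^ n)%N] | 'P].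
Proof.
move=> m_gt0 trA; pose i0 := const_point (Ordinal m_gt0).
apply/imsetP; exists i0; rewrite ?inE //; apply/setP=> j; rewrite inE.
apply/esym/orbitP.
have cA t :
    exists2 g, g \in A & g (tnth (lex_tuple i0) t) = tnth (lex_tuple j) t.
  have [||g Ag /esym E] := atransP2 trA (x := tnth (lex_tuple i0) t)
    (y := tnth (lex_tuple j) t); rewrite ?inE //.
  by exists g.
pose u := [ffun t => s2val (sig2_eqW (cA t))].
exists (base_perm u).
  rewrite -[base_perm u]mulg1 -(top1 m n).
  apply/imset2P; exists u 1; rewrite ?group1 //.
  by apply/ffun_onP => t; rewrite ffunE; case: sig2_eqW.
apply: (can_inj (@lex_tupleK m n)); apply: eq_from_tnth => t.
by rewrite /= apermE tnth_base ffunE; case: sig2_eqW.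
Qed.

Lemma top_in_exponentiation (A : {group {perm 'I_m}})
    (B : {group {perm 'I_n}}) s :
  s \in B -> top_perm m s \in exponentiation A B.
Proof.
move=> Bs; rewrite -[top_perm m s]mul1g -base1.
apply/imset2P; exists [ffun=> 1] s => //.
by apply/ffun_onP => t; rewrite ffunE.
Qed.

Lemma single_top_in_exponentiation (A : {group {perm 'I_m}})
    (B : {group {perm 'I_n}}) p g s :
  g \in A -> s \in B -> single p g * top_perm m s \in exponentiation A B.
Proof.
move=> Ag Bs; apply/imset2P; exists [ffun t => if t == p then g else 1] s => //.
by apply/ffun_onP => t; rewrite ffunE; case: eqP.
Qed.

(** With three coordinates at hand, differences supported on [p, q] and on
    [p, r] have a commutator supported on [p] only, equal to [[~ c, d]] there.
    Hence the preimage [N] in [A] of [H] under the [p]-th coordinate embedding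
    is normal with abelian quotient, and perfectness forces it to be [A]. *)
Lemma single_in_of_differences (H : {group {perm 'I_(m ^ n)%N}})
    (A : {group {perm 'I_m}}) c d :
    2 < n -> A^`(1) = A -> A = <<[set c; d]>> :> {set _} ->
    (forall q p, (single q c)^-1 * single p c \in H) ->
    (forall q p, (single q d)^-1 * single p d \in H) ->
  forall p g, g \in A -> single p g \in H.
Proof.
move=> n_gt2 perfA genA Hc Hd p.
have [q [r [pq pr qr]]] : exists q r : 'I_n, [/\ p != q, p != r & q != r].
  have : 1 < #|[set~ p]|.
    have := cardsC [set p]; rewrite cards1 card_ord => E.
    by rewrite -(ltn_add2l 1) E.
  case/card_gt1P => q [r] [] ; rewrite !inE => qp rp qr.
  by exists q, r; split; rewrite // eq_sym.
pose f : {morphism [set: {perm 'I_m}] >-> {perm 'I_(m ^ n)%N}} :=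
  Morphism (in2W (singleM p)).
pose N := (f @*^-1 H)%G.
have NE g : (g \in N) = (single p g \in H) by rewrite !inE.
suff /subsetP sAN : A \subset N by move=> g /sAN; rewrite NE.
have nN e : (forall q p, (single q e)^-1 * single p e \in H) -> e \in 'N(N).
  move=> He; rewrite inE; apply/subsetP => _ /imsetP[g Ng ->].
  by rewrite NE -(single_conj _ _ pq) groupJ // -NE.
have sXN : [set c; d] \subset 'N(N).
  by apply/subsetP => e /set2P[] ->; exact: nN.
rewrite -perfA der1_min //; first by rewrite genA gen_subG.
rewrite genA quotient_gen // abelian_gen; apply: quotient_cents2r.
rewrite gen_subG; apply/subsetP => _ /imset2P[e e' Xe Xe' ->].
rewrite NE -(single_commutator _ _ pq pr qr) groupR //.
  by case/set2P: Xe => ->.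
by case/set2P: Xe' => ->.
Qed.

(** The point is that [z] commutes with the conjugating element [phi s] as well
    as with [phi (single j g)], so that it cancels in
    [[~ phi (single j g) * z, phi s]].  Differences that do not involve [j] are
    quotients of two that do. *)
Lemma difference_in (gT : finGroupType) (H : {group gT})
    (B : {group {perm 'I_n}}) (phi : {perm 'I_(m ^ n)%N} -> gT) j g z :
    [transitive B, on [set: 'I_n] | 'P] -> {morph phi : s t / s * t} ->
    (forall s, s \in B -> phi (top_perm m s) \in H) ->
    (forall s, s \in B -> commute z (phi (top_perm m s))) ->
    commute z (phi (single j g)) -> phi (single j g) * z \in H ->
  forall q p, phi ((single q g)^-1 * single p g) \in H.
Proof.
move=> trB phiM Hphi ztop zg Hz.
pose F := Morphism (in2W phiM : {in [set: _] &, {morph phi : s t / s * t}}).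
have phiV x : phi x^-1 = (phi x)^-1 by exact: (morphV F (in_setT x)).
have phiJ x y : phi (x ^ y) = phi x ^ phi y.
  by exact: (morphJ F (in_setT x) (in_setT y)).
have Hj p : phi ((single j g)^-1 * single p g) \in H.
  have [||s Ss /= E] := atransP2 trB (x := j) (y := p).
  - by rewrite inE.
  - by rewrite inE.
  rewrite apermE in E.
  have -> : phi ((single j g)^-1 * single p g)
      = (phi (single j g) * z)^-1
        * (phi (single j g) * z) ^ phi (top_perm m s).
    have sz := ztop s Ss.
    have zsp : commute z (phi (single p g)).
      rewrite E -singleJ phiJ conjgE.
      by apply: commuteM; [exact: commuteV | exact: commuteM].
    rewrite conjMg -phiJ singleJ -E (conjg_fixP (introT commgP sz)).
    rewrite phiM phiV; apply: (mulgI z).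
    rewrite invMg !mulgA mulgV mul1g -[LHS]mulgA.
    by apply: commuteM => //; exact: commuteV.
  by rewrite groupM ?groupV // groupJ // Hphi.
move=> q p.
rewrite (_ : _ * _ = ((single j g)^-1 * single q g)^-1
                     * ((single j g)^-1 * single p g)).
  by rewrite phiM phiV groupM ?groupV.
by rewrite invMg invgK mulgA mulgK.
Qed.

End ProductAction.

(** A perfect group is not a nontrivial subgroup of the abelian group 'S_2. *)
Lemma perfect_transitive_gt2 n (A : {group {perm 'I_n}}) :
  1 < n -> A^`(1) = A -> [transitive A, on [set: 'I_n] | 'P] -> 2 < n.
Proof.
move=> n_gt1 perfA trA; rewrite ltn_neqAle n_gt1 andbT; apply/negP => /eqP n2.
have A1 : A = 1%G.
  apply: val_inj => /=; rewrite -perfA; apply/derG1P.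
  have cS : abelian [set: {perm 'I_n}].
    by apply/cyclic_abelian/prime_cyclic; rewrite cardsT card_Sn -n2.
  exact: abelianS (subsetT _) cS.
move: trA; rewrite A1 => /atransP2 tr.
have [||g /set1P -> ] := tr (Ordinal (ltnW n_gt1)) (Ordinal n_gt1);
  rewrite ?inE //.
by rewrite act1 => /(congr1 val).
Qed.

(** * The generators of the finite levels *)

Section Tower.
Variables (m : nat -> nat) (m_gt1 : forall k, 1 < m k).
Variable S : forall k, {group {perm 'I_(m k)}}.

(** The coordinate of the base group of level [k.+1] that carries the new
    factor: it must be fixed by the generator of level [k], and from level 1 on
    it is constant so that [lower_group k] fixes it too. *)
Fixpoint anchor (f : forall k, 'I_(m k)) (k : nat) : 'I_(iter_deg m k) :=
  match k with
  | 0 => f 0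
  | k'.+1 => const_point (iter_deg m k') (f k'.+1)
  end.

Fixpoint tower_gen (c : forall k, {perm 'I_(m k)}) (f : forall k, 'I_(m k))
    (k : nat) : {perm 'I_(iter_deg m k)} :=
  match k with
  | 0 => c 0
  | k'.+1 => single (anchor f k') (c k'.+1)
             * top_perm (m k'.+1) (tower_gen c f k')
  end.

(** The copy of level [k.-1] in the top of level [k]; nothing lies below level 0,
    where the trivial group stands in for it. *)
Definition lower_group (k : nat) : {set {perm 'I_(iter_deg m k)}} :=
  match k with
  | 0 => 1
  | k'.+1 => [set top_perm (m k'.+1) s | s in iter_expo S k']
  end.

Lemma lower_group_sub k : lower_group k \subset iter_expo S k.
Proof.
case: k => [|k] /=; first by rewrite sub1G.
by apply/subsetP => _ /imsetP[s Ss ->]; exact: top_in_exponentiation.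
Qed.

Lemma lower_group_anchor f k s :
  s \in lower_group k -> s (anchor f k) = anchor f k.
Proof.
case: k s => [|k] s /=; first by move/set1P ->; rewrite perm1.
by case/imsetP => t _ ->; exact: top_const_point.
Qed.

Lemma iter_expo_transitive k :
  (forall j, [transitive S j, on [set: 'I_(m j)] | 'P]) ->
  [transitive iter_expo S k, on [set: 'I_(iter_deg m k)] | 'P].
Proof.
move=> trS; case: k => [|k] //=.
by apply: exponentiation_transitive; rewrite // ltnW.
Qed.

Section Generator.
Variables (c : forall k, {perm 'I_(m k)}) (f : forall k, 'I_(m k)).
Hypothesis Sc : forall k, c k \in S k.
Hypothesis fix_c : forall k, c k (f k) = f k.

Lemma tower_gen_in k : tower_gen c f k \in iter_expo S k.
Proof. by elim: k => //= k IH; exact: single_top_in_exponentiation. Qed.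

Lemma tower_gen_anchor k : tower_gen c f k (anchor f k) = anchor f k.
Proof.
case: k => [|k] /=; first exact: fix_c.
by rewrite permM single_const_point ?top_const_point.
Qed.

Lemma tower_gen_proj k :
  iter_expo_proj m_gt1 S k (tower_gen c f k.+1) = tower_gen c f k.
Proof.
apply: expo_projE => //; last exact: tower_gen_in.
by apply/ffun_onP => t; rewrite ffunE; case: eqP.
Qed.

End Generator.

(** * Generation of the finite levels *)

Section Step.
Variables (gT : finGroupType) (c : forall k, {perm 'I_(m k)}).
Variable f : forall k, 'I_(m k).
Hypothesis Sc : forall k, c k \in S k.
Hypothesis fix_c : forall k, c k (f k) = f k.
Hypothesis coprime_c : forall j, 0 < j -> coprime #[c 0] #[c j].

(** Seen through a homomorphism [phi] from level [k] into a larger group, a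
    generator of the larger group is [phi (tower_gen c f k) * z], where [z]
    gathers the factors of the levels above [k].  Those factors sit in anchors
    fixed by [lower_group k] and by [tower_gen c f k], but in general not by
    all of level [k]; this is what can be asked of [z]. *)
Definition admissible_twist k (phi : {perm 'I_(iter_deg m k)} -> gT) z :=
  [/\ forall s, s \in lower_group k -> commute z (phi s),
      commute z (phi (tower_gen c f k)) & coprime #[c 0] #[z]].

Lemma admissible_twist_single k (phi : {perm 'I_(iter_deg m k.+1)} -> gT) z :
  {morph phi : s t / s * t} -> admissible_twist phi z ->
  commute z (phi (single (anchor f k) (c k.+1))).
Proof.
move=> phiM [zl zc _].
rewrite (_ : single _ _ = tower_gen c f k.+1 *
    top_perm (m k.+1) (tower_gen c f k)^-1).
  rewrite phiM; apply: commuteM => //; apply: zl.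
  by apply: imset_f; rewrite groupV tower_gen_in.
by rewrite /= -mulgA -top_permM mulgV top1 mulg1.
Qed.

(** Descending one level moves the top factor of the generator into the twist:
    that factor sits in [anchor f k], which is fixed by everything that the new
    twist has to commute with. *)
Lemma admissible_twist_step k (phi : {perm 'I_(iter_deg m k.+1)} -> gT) z :
  {morph phi : s t / s * t} -> admissible_twist phi z ->
  admissible_twist (fun s => phi (top_perm (m k.+1) s))
    (phi (single (anchor f k) (c k.+1)) * z).
Proof.
move=> phiM zP; have zs := admissible_twist_single phiM zP.
have [zl zc zcop] := zP.
have cs s : s \in iter_expo S k -> s (anchor f k) = anchor f k ->
    commute (phi (single (anchor f k) (c k.+1)) * z)
            (phi (top_perm (m k.+1) s)).
  move=> Ss fs; apply/commute_sym/commuteM; last first.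
    by apply/commute_sym/zl/imset_f.
  by rewrite /commute -!phiM; congr phi; apply/commute_sym/single_commute_top.
have phi1 : phi 1 = 1 by apply: (mulgI (phi 1)); rewrite -phiM !mulg1.
have phiX x n : phi (x ^+ n) = phi x ^+ n.
  by elim: n => // n IH; rewrite !expgS phiM IH.
split=> [s sl|/=|].
- apply: cs; first by apply: (subsetP (lower_group_sub k)).
  exact: lower_group_anchor.
- by apply: cs; [exact: tower_gen_in | exact: tower_gen_anchor].
- apply: (@coprime_dvdr _ (#[c k.+1] * #[z])); last first.
    by rewrite coprimeMr coprime_c.
  rewrite order_dvdn expgMn; last exact: commute_sym.
  rewrite expgM -phiX -singleX expg_order single1 phi1 expg1n mul1g.
  by rewrite mulnC expgM expg_order expg1n.
Qed.

End Step.

Section Generation.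
Variables (c d : forall k, {perm 'I_(m k)}) (f e : forall k, 'I_(m k)).
Hypothesis perfect_S : forall k, (S k)^`(1) = S k.
Hypothesis trans_S : forall k, [transitive S k, on [set: 'I_(m k)] | 'P].
Hypothesis gen_S : forall k, S k = <<[set c k; d k]>> :> {set _}.
Hypothesis fix_c : forall k, c k (f k) = f k.
Hypothesis fix_d : forall k, d k (e k) = e k.
Hypothesis coprime_c : forall j, 0 < j -> coprime #[c 0] #[c j].
Hypothesis coprime_d : forall j, 0 < j -> coprime #[d 0] #[d j].

Lemma iter_deg_gt2 k : 2 < iter_deg m k.
Proof.
elim: k => [|k IH] /=; first exact: perfect_transitive_gt2.
exact: leq_trans IH (ltnW (ltn_expl _ (m_gt1 _))).
Qed.

(** At level 0 the generators are separated from their twists by coprimality of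
    the orders.  At level [k.+1], the same generators seen from level [k], with
    larger twists, yield the whole of [lower_group k.+1]; dividing it out leaves
    the twisted factor [phi (single _ (c k.+1)) * z], which
    [difference_in] and [single_in_of_differences] turn into the base group. *)
Lemma iter_expo_sub_twisted k :
  forall (gT : finGroupType) (phi : {perm 'I_(iter_deg m k)} -> gT) z w,
    {morph phi : s t / s * t} ->
    admissible_twist c f phi z -> admissible_twist d e phi w ->
  forall s, s \in iter_expo S k ->
    phi s \in <<[set phi (tower_gen c f k) * z; phi (tower_gen d e k) * w]>>.
Proof.
elim: k => [|k IH] gT phi z w phiM zP wP.
  pose H := <<[set phi (c 0) * z; phi (d 0) * w]%g>>%G.
  change (forall s, s \in S 0 -> phi s \in H).
  pose F := Morphism (in2W phiM : {in [set: _] &, {morph phi : s t / s * t}}).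
  have cyc x y : commute y (phi x) -> coprime #[x] #[y] -> phi x * y \in H ->
      phi x \in H.
    move=> xy co Hxy; have : phi x \in <[phi x * y]>.
      apply: (subsetP (cycleMsub (commute_sym xy) _)); last exact: cycle_id.
      exact: coprime_dvdl (morph_order F (in_setT x)) co.
    by apply/subsetP; rewrite cycle_subG.
  suff sSH : S 0 \subset F @*^-1 H.
    by move=> s /(subsetP sSH); rewrite !inE.
  rewrite gen_S gen_subG; apply/subsetP => x /set2P[] ->; rewrite !inE /=.
    by case: zP => _ zc co; apply: cyc zc co _; rewrite mem_gen ?set21.
  by case: wP => _ wc co; apply: cyc wc co _; rewrite mem_gen ?set22.
have Sc j : c j \in S j by rewrite gen_S mem_gen ?set21.
have Sd j : d j \in S j by rewrite gen_S mem_gen ?set22.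
have zP' := admissible_twist_step Sc fix_c coprime_c phiM zP.
have wP' := admissible_twist_step Sd fix_d coprime_d phiM wP.
have topM : {morph (fun s => phi (top_perm (m k.+1) s)) : s t / s * t}.
  by move=> s t; rewrite top_permM phiM.
have := IH _ _ _ _ topM zP' wP'.
have regroup (c' : forall j, {perm 'I_(m j)}) (f' : forall j, 'I_(m j)) y :
    (forall j, c' j (f' j) = f' j) ->
    phi (top_perm (m k.+1) (tower_gen c' f' k)) *
      (phi (single (anchor f' k) (c' k.+1)) * y) =
    phi (tower_gen c' f' k.+1) * y.
  move=> fix_c'; rewrite mulgA -phiM; congr (phi _ * y).
  by apply/commute_sym/single_commute_top/tower_gen_anchor.
pose H := <<[set phi (tower_gen c f k.+1) * z;
                 phi (tower_gen d e k.+1) * w]%g>>%G.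
rewrite !regroup // -[<<_>>]/(gval H) => topH.
have singleH (c' : forall j, {perm 'I_(m j)}) (f' : forall j, 'I_(m j)) y :
    (forall j, c' j \in S j) -> (forall j, c' j (f' j) = f' j) ->
    phi (tower_gen c' f' k.+1) * y \in H ->
    phi (single (anchor f' k) (c' k.+1)) * y \in H.
  move=> Sc' fix_c'; rewrite -regroup // groupMl //.
  by apply: topH; exact: tower_gen_in.
have cH : phi (single (anchor f k) (c k.+1)) * z \in H.
  by apply: singleH => //; rewrite mem_gen ?set21.
have dH : phi (single (anchor e k) (d k.+1)) * w \in H.
  by apply: singleH => //; rewrite mem_gen ?set22.
pose F := Morphism (in2W phiM : {in [set: _] &, {morph phi : s t / s * t}}).
pose K := (F @*^-1 H)%G.
have KE x : (x \in K) = (phi x \in H) by rewrite !inE.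
have SK p g : g \in S k.+1 -> single p g \in K.
  move: p g.
  have trT := iter_expo_transitive k trans_S.
  have zs := admissible_twist_single Sc phiM zP.
  have ws := admissible_twist_single Sd phiM wP.
  apply: (single_in_of_differences (iter_deg_gt2 k) (perfect_S k.+1)
            (gen_S k.+1)) => q p; rewrite KE.
    apply: (difference_in trT phiM topH _ zs cH).
    by case: zP => zl _ _ s Ss; apply/zl/imset_f.
  apply: (difference_in trT phiM topH _ ws dH).
  by case: wP => wl _ _ s Ss; apply/wl/imset_f.
move=> _ /imset2P[u t /ffun_onP Su St ->].
rewrite phiM groupM //; last exact: topH.
by rewrite -KE; apply: base_perm_in => j; exact: SK.
Qed.

Lemma iter_expo_generated k :
  iter_expo S k = <<[set tower_gen c f k; tower_gen d e k]>> :> {set _}.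
Proof.
have Sc j : c j \in S j by rewrite gen_S mem_gen ?set21.
have Sd j : d j \in S j by rewrite gen_S mem_gen ?set22.
apply/eqP; rewrite eqEsubset gen_subG; apply/andP; split; last first.
  by apply/subsetP => x /set2P[] ->; exact: tower_gen_in.
have triv c' f' :
    admissible_twist c' f' (fun s : {perm 'I_(iter_deg m k)} => s) 1.
  by split=> [s _||]; rewrite ?order1 ?coprimen1 //; apply/commute_sym/commute1.
apply/subsetP => s Ss.
have := iter_expo_sub_twisted (fun _ _ => erefl) (triv c f) (triv d e) Ss.
by rewrite !mulg1.
Qed.

End Generation.
End Tower.

(** * Density in an inverse limit *)

Section InverseLimitDensity.
Variables (gT : nat -> finGroupType) (G : forall k, {group gT k}).
Variable pi : forall k, {morphism G k.+1 >-> gT k}.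
Local Notation L := (inverse_limit pi).

Lemma inverse_limit_agree (y z : L) K j :
  j <= K -> val y K = val z K -> val y j = val z j.
Proof.
move=> /subnK <-; elim: (K - j)%N => // i IH E; apply: IH.
by rewrite -(inverse_limitP y _).2 -(inverse_limitP z _).2 -E.
Qed.

(** A basic open set of the product restricts finitely many coordinates, and in
    an inverse limit the last of them determines the others.  The proof shows
    that the filter of agreement with [z] on initial segments converges to
    [z]. *)
Lemma open_inverse_limit_coordinate (O : set L) (z : L) : open O -> O z ->
  exists K, forall y : L, val y K = val z K -> O y.
Proof.
case=> V Vopen <- Vz.
pose T := prod_topology (fun k => discrete_topology (gT k)).
pose B K : set T := fun u => forall j, j <= K -> u j = val z j.
have FB : Filter (filter_from classical_sets.setT B).
  apply: filter_fromT_filter; first by exists 0.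
  move=> i j; exists (maxn i j) => u Bu.
  by split=> l le_l; apply: Bu; rewrite leq_max le_l ?orbT.
have cvgB : (filter_from classical_sets.setT B --> (val z : T))%classic.
  apply/cvg_sup => k U [W [[A oA <-] /= Az WU]].
  exists k => // u Bu; apply: WU => /=.
  by rewrite (Bu k (leqnn k)).
have [K _ BK] : filter_from classical_sets.setT B V.
  by apply: cvgB; apply: open_nbhs_nbhs.
exists K => y E; apply: BK => j le_jK.
exact: inverse_limit_agree E.
Qed.

Lemma inverse_limit_generated (x y : forall k, gT k) :
    (forall k, G k = <<[set x k; y k]>> :> {set gT k}) ->
    (forall k, pi k (x k.+1) = x k) -> (forall k, pi k (y k.+1) = y k) ->
  topologically_2_generated (inverse_limit pi).
Proof.
move=> genG pix piy.
have Lx : inverse_limit_set pi x.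
  by move=> k; rewrite pix genG mem_gen ?set21.
have Ly : inverse_limit_set pi y.
  by move=> k; rewrite piy genG mem_gen ?set22.
pose X : L := exist (fun u => u \in inverse_limit_set pi) _ (mem_set Lx).
pose Y : L := exist (fun u => u \in inverse_limit_set pi) _ (mem_set Ly).
exists X, Y; set D := generated_subgroup _.
have D1 : D 1 by move=> H [[H1 _] _].
have DV u v : D u -> D v -> D (u * v^-1).
  move=> Du Dv H HP; have [[_ HV] _] := HP.
  by apply: HV; [apply: Du | apply: Dv].
have DM u v : D u -> D v -> D (u * v).
  move=> Du Dv; rewrite -[v]invgK; apply: (DV) => //.
  by rewrite -[v^-1]mul1g; apply: DV.
have DX : D X by move=> H [_]; apply; left.
have DY : D Y by move=> H [_]; apply; right.
move=> O [z Oz] Oopen; have [K OK] := open_inverse_limit_coordinate Oopen Oz.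
pose P := [set p : gT K | `[< exists2 u, D u & val u K = p >]].
have gP : group_set P.
  apply/group_setP; split; first by rewrite inE; apply/asboolP; exists 1.
  move=> p q; rewrite !inE => /asboolP[u Du <-] /asboolP[v Dv <-].
  by apply/asboolP; exists (u * v) => //; exact: DM.
have sGP : G K \subset Group gP.
  rewrite genG gen_subG.
  apply/subsetP => p /set2P[] ->; rewrite inE; apply/asboolP.
    by exists X.
  by exists Y.
have := subsetP sGP _ (inverse_limitP z K).1; rewrite inE => /asboolP[u Du uz].
by exists u; split=> //; exact: OK.
Qed.

End InverseLimitDensity.

Theorem corollary9
    (m : nat -> nat) (m_gt1 : forall k, 1 < m k)
    (S : forall k, {group {perm 'I_(m k)}})
    (perfect_S : forall k, (S k)^`(1)%g = S k)
    (trans_S : forall k, [transitive S k, on [set: 'I_(m k)] | 'P])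
    (a b : forall k, {perm 'I_(m k)})
    (gen_S : forall k, S k = <<[set a k; b k]>>%g :> {set {perm 'I_(m k)}})
    (fix_a : forall k, exists i : 'I_(m k), a k i = i)
    (fix_b : forall k, exists i : 'I_(m k), b k i = i)
    (coprime_ab : forall j, 0 < j -> coprime #[a 0]%g #[b j]%g)
    (coprime_ba : forall j, 0 < j -> coprime #[b 0]%g #[a j]%g) :
  topologically_2_generated (infinite_iter_expo m_gt1 S).
Proof.
(* Level 0 is swapped, so that the coprimality hypotheses compare the first
   factor of each generator with its own later factors. *)
pose c k := if k is 0 then a k else b k.
pose d k := if k is 0 then b k else a k.
have [f fix_c] : exists f : forall k, 'I_(m k), forall k, c k (f k) = f k.
  have fix_ex k : exists i, c k i = i.
    by case: k => [|k]; [exact: fix_a | exact: fix_b].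
  exists (fun k => sval (cid (fix_ex k))) => k.
  exact: (svalP (cid (fix_ex k))).
have [e fix_d] : exists e : forall k, 'I_(m k), forall k, d k (e k) = e k.
  have fix_ex k : exists i, d k i = i.
    by case: k => [|k]; [exact: fix_b | exact: fix_a].
  exists (fun k => sval (cid (fix_ex k))) => k.
  exact: (svalP (cid (fix_ex k))).
have gen_cd k : S k = <<[set c k; d k]>> :> {set {perm 'I_(m k)}}.
  by case: k => [|k]; rewrite gen_S // finset.setUC.
have coprime_c j : 0 < j -> coprime #[c 0] #[c j].
  by case: j => // j; apply: coprime_ab.
have coprime_d j : 0 < j -> coprime #[d 0] #[d j].
  by case: j => // j; apply: coprime_ba.
apply: (@inverse_limit_generated _ _ _ (tower_gen c f) (tower_gen d e)).
- exact: iter_expo_generated.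
- by apply: tower_gen_proj => // k; rewrite gen_cd mem_gen ?set21.
- by apply: tower_gen_proj => // k; rewrite gen_cd mem_gen ?set22.
Qed.
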